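(* For any projection algebra $P$, the free regular $*$-semigroup $\mathsf{PG}(P)$ has the semigroup presentation $$\mathsf{PG}(P)\cong\langle X_P:R_P\rangle,$$ where $X_P=\{x_p:p\in P\}$ is an alphabet in one-one correspondence with $P$, and where $R_P$ is the set of relations $$x_p^2=x_p\ \ (p\in P),\qquad (x_px_q)^2=x_px_q\ \ (p,q\in P),\qquad x_px_qx_p=x_{q\theta_p}\ \ (p,q\in P).$$
   Context: Maps are written to the right of their arguments and composed left to right. For a set $X$ and $R\subseteq X^+\times X^+$ (with $X^+$ the free semigroup on $X$), $\langle X:R\rangle$ denotes the semigroup $X^+/R^\sharp$, where $R^\sharp$ is the congruence on $X^+$ generated by $R$; a pair $(u,v)\in R$ is written $u=v$. A projection algebra is a set $P$ with unary operations $\theta_p:P\to P$ ($p\in P$) such that for all $p,q\in P$: $p\theta_p=p$; $\theta_p\theta_p=\theta_p$; $p\theta_q\theta_p=q\theta_p$; $\theta_p\theta_q\theta_p=\theta_{q\theta_p}$; $\theta_p\theta_q\theta_p\theta_q=\theta_p\theta_q$. On $P$ define $p\leq_{\mathscr F}q$ iff $p=q\theta_p$; $p\mathrel{\mathscr F}q$ iff $p\leq_{\mathscr F}q$ and $q\leq_{\mathscr F}p$. A $P$-path is a tuple $(p_1,\ldots,p_k)$ ($k\geq1$) with $p_1\mathrel{\mathscr F}\cdots\mathrel{\mathscr F}p_k$, regarded as a morphism $p_1\to p_k$; the path category $\mathscr P(P)$ consists of all $P$-paths under $(p_1,\ldots,p_k)\circ(p_k,\ldots,p_l)=(p_1,\ldots,p_k,\ldots,p_l)$,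 with identities $(p)$. A pair $(e,f)\in P\times P$ is $p$-linked ($p\in P$) if $f=e\theta_p\theta_f$ and $e=f\theta_p\theta_e$. Let $\equiv$ be the (category) congruence on $\mathscr P(P)$ generated by all pairs $((p,p),(p))$ with $p\in P$, all $((p,q,p),(p))$ with $p\mathrel{\mathscr F}q$, and all $((e,e\theta_p,f),(e,f\theta_p,f))$ with $p\in P$ and $(e,f)$ $p$-linked. The class of $(p_1,\ldots,p_k)$ is denoted $[\![p_1,\ldots,p_k]\!]$. The free (projection-generated) regular $*$-semigroup $\mathsf{PG}(P)$ consists of all these classes, with $[\![p_1,\ldots,p_k]\!]^*=[\![p_k,\ldots,p_1]\!]$ and $[\![p_1,\ldots,p_k]\!]\bullet[\![q_1,\ldots,q_l]\!]=[\![p_1',\ldots,p_k',q_1',\ldots,q_l']\!]$, where, with $p'=q_1\theta_{p_k}$ and $q'=p_k\theta_{q_1}$, $p_i'=p'\theta_{p_k}\cdots\theta_{p_i}$ and $q_j'=q'\theta_{q_1}\cdots\theta_{q_j}$. *)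

(* Defs.v *)
From HB Require Import structures.
From mathcomp Require Import all_boot boolp.

Set Implicit Arguments.
Unset Strict Implicit.
Unset Printing Implicit Defensive.

Local Open Scope quotient_scope.

(** Nonempty words: the carrier of the free semigroup [X^+]. *)
Record word (X : Type) := Word { wseq :> seq X; wseqP : 0 < size wseq }.

HB.instance Definition _ X := gen_eqMixin (word X).
HB.instance Definition _ X := gen_choiceMixin (word X).

Section FreeSemigroup.
Variable X : Type.
Implicit Types u v w : word X.

Lemma word_inj u v : wseq u = wseq v -> u = v.
Proof.
case: u v => [s hs] [t ht] /= e; case: t / e ht => ht.
by congr Word; exact: bool_irrelevance.
Qed.

Fact word_cat_subproof u v : 0 < size (u ++ v).
Proof. by rewrite size_cat addn_gt0 (wseqP u). Qed.

Definition word_cat u v : word X := Word (word_cat_subproof u v).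

Fact word_catA : associative word_cat.
Proof. by move=> u v w; apply: word_inj; rewrite /= catA. Qed.

HB.instance Definition _ := isSemigroup.Build (word X) word_catA.

Definition letter (x : X) : word X := @Word X [:: x] isT.

End FreeSemigroup.

(** [R^sharp], the least congruence containing [R]. *)
Inductive cong_gen (S : semigroupType) (R : S -> S -> Prop) : S -> S -> Prop :=
| cong_base u v of R u v : cong_gen R u v
| cong_refl u : cong_gen R u u
| cong_sym u v of cong_gen R u v : cong_gen R v u
| cong_trans v u w of cong_gen R u v & cong_gen R v w : cong_gen R u w
| cong_mul u u' v v' of cong_gen R u u' & cong_gen R v v' :
    cong_gen R (u * v)%g (u' * v')%g.

Section Presentation.
Variables (X : Type) (R : word X -> word X -> Prop).

Definition pres_rel (u v : word X) : bool := `[< cong_gen R u v >].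

Fact pres_rel_refl : reflexive pres_rel.
Proof. by move=> u; apply/asboolP; apply: cong_refl. Qed.

Fact pres_rel_sym : symmetric pres_rel.
Proof. by move=> u v; apply/asboolP/asboolP; apply: cong_sym. Qed.

Fact pres_rel_trans : transitive pres_rel.
Proof.
by move=> v u w /asboolP uv /asboolP vw; apply/asboolP; apply: cong_trans uv vw.
Qed.

Canonical pres_equiv := EquivRel pres_rel pres_rel_refl pres_rel_sym pres_rel_trans.

(** The semigroup [<X : R>]. *)
Definition presented := {eq_quot pres_equiv}.

HB.instance Definition _ := Choice.on presented.
HB.instance Definition _ := EqQuotient.on presented.

Definition pres_mul : presented -> presented -> presented :=
  lift_op2 presented (fun u v : word X => (u * v)%g).

Lemma presentedP u v : \pi_presented u = \pi_presented v <-> cong_gen R u v.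
Proof. by split=> [/eqmodP/asboolP//|uv]; apply/eqmodP/asboolP. Qed.

Fact pi_pres_mul :
  {morph \pi_presented : u v / (u * v)%g >-> pres_mul u v}.
Proof.
move=> u v; unlock pres_mul; apply/presentedP.
by apply: cong_mul; apply/presentedP; rewrite reprK.
Qed.

Fact pres_mulA : associative pres_mul.
Proof.
elim/quotW=> u; elim/quotW=> v; elim/quotW=> w.
by rewrite -!pi_pres_mul mulgA.
Qed.

HB.instance Definition _ := isSemigroup.Build presented pres_mulA.

End Presentation.

(** [th p] is the operation [theta_p]; as these operations are written on the
    right of their arguments, [x \T_ p] stands for [x theta_p] and
    [x \T_ p \T_ q] for [x theta_p theta_q]. *)
Reserved Notation "x \T_ p" (at level 40, p at level 39, left associativity,
  format "x  \T_ p").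

HB.mixin Record isProjectionAlgebra P := {
  th : P -> P -> P;
  th_id : forall p, th p p = p;
  th_idem : forall p x, th p (th p x) = th p x;
  th_proj : forall p q, th p (th q p) = th p q;
  th_conj : forall p q x, th p (th q (th p x)) = th (th p q) x;
  th_mul2 : forall p q x, th q (th p (th q (th p x))) = th q (th p x)
}.

#[short(type="projectionAlgebra")]
HB.structure Definition ProjectionAlgebra := {P of isProjectionAlgebra P}.

Notation "x \T_ p" := (th p x).

Section Paths.
Variable P : projectionAlgebra.
Implicit Types p q r e f x y z w : P.

Definition leF p q : Prop := p = q \T_p.

Definition frel p q : bool := `[< leF p q /\ leF q p >].

Definition is_ppath (s : seq P) : bool :=
  if s is p :: s' then path frel p s' else false.

Record ppath := PPath { pseq :> seq P; ppathP : is_ppath pseq }.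

HB.instance Definition _ := gen_eqMixin ppath.
HB.instance Definition _ := gen_choiceMixin ppath.

(** Paths are nonempty, so both of these are of the form [Some _]. *)
Definition pdom (a : ppath) : option P := ohead a.
Definition pcod (a : ppath) : option P := ohead (rev a).

Lemma is_ppath_cat (s t : seq P) p q :
  is_ppath (rcons s p ++ q :: t) =
  [&& is_ppath (rcons s p), frel p q & is_ppath (q :: t)].
Proof. by case: s => [|x s] //=; rewrite cat_path last_rcons. Qed.

Fact pcomp_subproof (a b : ppath) :
  pcod a = pdom b -> is_ppath (pseq a ++ behead b).
Proof.
case: a b => [s +] [[|q t] //]; case/lastP: s => [//|s p] /= hs ht.
rewrite /pcod /pdom /= rev_rcons /= => -[pq]; rewrite -{q}pq in ht.
by case: t ht => [|q t] ht; rewrite ?cats0 // is_ppath_cat hs.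
Qed.

Definition pcomp (a b : ppath) (h : pcod a = pdom b) : ppath :=
  PPath (pcomp_subproof h).

Definition linked p e f : Prop := f = e \T_p \T_f /\ e = f \T_p \T_e.

Inductive pgen : seq P -> seq P -> Prop :=
| pgen_id p : pgen [:: p; p] [:: p]
| pgen_inv p q of frel p q : pgen [:: p; q; p] [:: p]
| pgen_linked p e f of linked p e f :
    pgen [:: e; e \T_p; f] [:: e; f \T_p; f].

(** The category congruence generated by [pgen], closed under all defined
    composites. It relates only paths with the same endpoints ([pcong_ends]).
    The sequences related by [pgen_linked] are always paths ([req_linked]), so
    restricting [pcong_base] to paths loses none of them. *)
Inductive pcong : ppath -> ppath -> Prop :=
| pcong_base (a b : ppath) of pgen a b : pcong a b
| pcong_refl a : pcong a a
| pcong_sym a b of pcong a b : pcong b a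
| pcong_trans b a c of pcong a b & pcong b c : pcong a c
| pcong_comp a a' b b' (h : pcod a = pdom b) (h' : pcod a' = pdom b')
    of pcong a a' & pcong b b' : pcong (pcomp h) (pcomp h').

Definition pcongb (a b : ppath) : bool := `[< pcong a b >].

Fact pcongb_refl : reflexive pcongb.
Proof. by move=> a; apply/asboolP; apply: pcong_refl. Qed.

Fact pcongb_sym : symmetric pcongb.
Proof. by move=> a b; apply/asboolP/asboolP; apply: pcong_sym. Qed.

Fact pcongb_trans : transitive pcongb.
Proof.
by move=> b a c /asboolP ab /asboolP bc; apply/asboolP; apply: pcong_trans ab bc.
Qed.

Canonical pcong_equiv := EquivRel pcongb pcongb_refl pcongb_sym pcongb_trans.

(** With [s = (p_1, ..., p_k)] and [t = (q_1, ..., q_l)] this is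
    [(p'_1, ..., p'_k, q'_1, ..., q'_l)], where [p' = q_1 theta_{p_k}],
    [q' = p_k theta_{q_1}], [p'_i = p' theta_{p_k} ... theta_{p_i}] and
    [q'_j = q' theta_{q_1} ... theta_{q_j}]: recall that
    [scanl f x [:: y1; y2; ...]] is [[:: f x y1; f (f x y1) y2; ...]]. *)
Definition bullet_seq (s t : seq P) : seq P :=
  match rev s, t with
  | pk :: _, q1 :: _ =>
      rev (scanl (fun x p => x \T_p) (q1 \T_pk) (rev s)) ++
      scanl (fun x q => x \T_q) (pk \T_q1) t
  | _, _ => [::]
  end.

Lemma frelP p q : reflect (q \T_p = p /\ p \T_q = q) (frel p q).
Proof. by apply: (iffP (asboolP _)) => -[h1 h2]; split; symmetry. Qed.

Lemma frel_sym p q : frel p q = frel q p.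
Proof. by apply/frelP/frelP => -[]. Qed.

Lemma frel_refl p : frel p p.
Proof. by apply/frelP; rewrite th_id. Qed.

Lemma frel_th p q : frel (q \T_p) (p \T_q).
Proof. by apply/frelP; rewrite -!th_conj !th_proj. Qed.

(* [r \T_p = r] means that [r] lies below [p]. *)
Lemma th_below x p r : r \T_p = r -> x \T_p \T_r \T_p = x \T_r.
Proof. by move=> {2}<-; rewrite th_conj. Qed.

Lemma th_belowl x p r : r \T_p = r -> x \T_p \T_r = x \T_r.
Proof. by move=> h; rewrite -(th_below _ h) th_idem th_below. Qed.

Lemma th_belowr x p r : r \T_p = r -> x \T_r \T_p = x \T_r.
Proof. by move=> h; rewrite -(th_below x h) th_idem. Qed.

Lemma frel_thK x p q : frel p q -> x \T_p \T_q \T_p = x \T_p.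
Proof. by case/frelP=> h _; rewrite th_conj h. Qed.

Lemma frel_below p q r : frel p q -> r \T_p = r -> frel r (r \T_q).
Proof.
move=> pq h; have [h1 h2] := frelP _ _ pq; apply/frelP; split; last first.
  by rewrite -th_conj !th_proj.
by rewrite th_proj -(th_below _ h) h1 -{2}h th_proj.
Qed.

Lemma linked_frel p e f : linked p e f -> frel e (e \T_p) && frel (e \T_p) f.
Proof.
have half e' f' : linked p e' f' -> frel e' (e' \T_p).
  case=> hf he; apply/frelP; rewrite th_proj; split; last first.
    by rewrite -th_conj !th_proj.
  by rewrite -th_proj; have := congr1 (fun z => z \T_p \T_e') he; rewrite th_mul2 -he.
move=> /[dup] -[hf he] L; rewrite (half _ _ L) /=.
apply/frelP; rewrite -hf; split => //.
by rewrite -th_conj -he.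
Qed.

(* [L r (p_1, ..., p_k)] restricts a path to [r], for [r] below [p_1]; [E] is
   the endpoint of the result. *)
Let L := @scanl P P (fun x p => x \T_p).
Let E := foldl (fun x p => x \T_p).

Definition req (s t : seq P) : Prop :=
  exists a b : ppath, [/\ pseq a = s, pseq b = t & pcong a b].

Lemma ppath_inj (a b : ppath) : pseq a = pseq b -> a = b.
Proof.
case: a b => [s hs] [t ht] /= e; case: t / e ht => ht.
by congr PPath; exact: bool_irrelevance.
Qed.

Lemma reqP (a b : ppath) : req a b -> pcong a b.
Proof. by case=> [a' [b' [/ppath_inj <- /ppath_inj <-]]]. Qed.

Lemma req_refl s : is_ppath s -> req s s.
Proof. by move=> h; exists (PPath h), (PPath h); split=> //; apply: pcong_refl. Qed.

Lemma req_sym s t : req s t -> req t s.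
Proof. by case=> [a [b [<- <- ab]]]; exists b, a; split=> //; apply: pcong_sym. Qed.

Lemma req_trans t s u : req s t -> req t u -> req s u.
Proof.
case=> [a [b [<- <- ab]]] [b' [c [/ppath_inj e <- bc]]].
by exists a, c; split=> //; rewrite e in bc; apply: pcong_trans ab bc.
Qed.

Lemma req_base s t : is_ppath s -> is_ppath t -> pgen s t -> req s t.
Proof. by move=> hs ht g; exists (PPath hs), (PPath ht); split=> //; apply: pcong_base. Qed.

Lemma req_ppath s t : req s t -> is_ppath s /\ is_ppath t.
Proof. by case=> [[s' hs] [[t' ht] [/= <- <-]]]. Qed.

Lemma pcong_ends a b : pcong a b -> pdom a = pdom b /\ pcod a = pcod b.
Proof.
elim=> {a b} [a b g||a b _ [-> ->]|b a c _ [-> ->]|a a' b b' h h' _ [ha hc] _ [hb hd]] //.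
  by rewrite /pdom /pcod; case: g.
move: a a' b b' h h' ha hc hb hd => [s hs] [s' hs'] [[|x t] // ht] [[|x' t'] // ht'].
rewrite /pdom /pcod /= !rev_cat !rev_cons.
case/lastP: s hs => // s y _; case/lastP: s' hs' => // s' y' _.
rewrite !rev_rcons /= => -[->] -[->] h _ [e]; rewrite -{x' ht'}e in h * => hd; split.
  by case: s h => [|? ?]; case: s' => [|? ?] /=. 
by case/lastP: t {ht} hd => [|t z]; case/lastP: t' => [|t' z'];
  rewrite ?rev_rcons.
Qed.

Lemma req_ends s t : req s t -> ohead s = ohead t /\ ohead (rev s) = ohead (rev t).
Proof. by case=> [a [b [<- <- /pcong_ends]]]. Qed.

Lemma req_comp x s s' t t' :
  req s s' -> req (x :: t) (x :: t') -> ohead (rev s) = Some x ->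
  req (s ++ t) (s' ++ t').
Proof.
move=> ss' tt' e; have [_ e'] := req_ends ss'; rewrite e in e'.
case: ss' e e' => [a [a' [<- <- aa']]] e e'.
case: tt' => [b [b' [eb eb' bb']]].
have h : pcod a = pdom b by rewrite /pdom eb.
have h' : pcod a' = pdom b' by rewrite /pdom eb' /pcod -e'.
exists (pcomp h), (pcomp h'); split; rewrite /= ?eb ?eb' //.
exact: pcong_comp.
Qed.

Lemma req_catl l s t : req s t -> is_ppath (l ++ s) -> req (l ++ s) (l ++ t).
Proof.
move=> st; have [+ _] := req_ends st.
case: s t st => [|x s] t st; first by have [] := req_ppath st.
case: t st => [|x' t] st //= -[e]; rewrite -{x'}e in st *.
rewrite -!cat_rcons => h; apply: (req_comp (x := x)) => //; last first.
  by rewrite rev_rcons.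
apply: req_refl; move: h; case: l => [|y l] //=.
by rewrite cat_path => /andP[].
Qed.

Lemma is_ppath_rev s : is_ppath (rev s) = is_ppath s.
Proof.
suff h t : is_ppath t -> is_ppath (rev t).
  by apply/idP/idP => [/h|/h //]; rewrite revK.
elim: t => // x [//|y t] IH /= /andP[xy yt].
by rewrite 2!rev_cons -cats1 is_ppath_cat -rev_cons IH //= frel_sym xy.
Qed.

Lemma linked_sym p e f : linked p e f -> linked p f e.
Proof. by case. Qed.

Lemma req_linked p e f :
  linked p e f -> req [:: e; e \T_p; f] [:: e; f \T_p; f].
Proof.
move=> l; apply: req_base; last exact: pgen_linked.
  by have /andP[h1 h2] := linked_frel l; rewrite /= h1 h2.
by have /andP[h1 h2] := linked_frel (linked_sym l);
  rewrite /= frel_sym h2 frel_sym h1.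
Qed.

Lemma req_id p : req [:: p; p] [:: p].
Proof.
by apply: req_base (pgen_id p) => //=; rewrite frel_refl.
Qed.

Lemma req_inv p q : frel p q -> req [:: p; q; p] [:: p].
Proof.
by move=> h; apply: req_base (pgen_inv h) => //=; rewrite h frel_sym h.
Qed.

Lemma req_rev s t : req s t -> req (rev s) (rev t).
Proof.
case=> [a [b [<- <- ab]]]; elim: ab => {s t a b}
  [a b g|a|a b _|b a c _ ab _|a a' b b' h h' _ aa' _ bb'].
- case: g => [p|p q h|p e f l]; rewrite /rev /=.
  + exact: req_id.
  + exact: req_inv.
  + exact: req_sym (req_linked (linked_sym l)).
- by apply: req_refl; rewrite is_ppath_rev ppathP.
- exact: req_sym.
- exact: req_trans ab.
- move: h h' aa' bb'; rewrite /pcod /pdom /= !rev_cat.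
  case: (pseq b) (ppathP b) => [//|x t] _; case: (pseq b') (ppathP b') => [//|x' t'] _ /=.
  case: (rev a) => [//|_ s] /= -[->]; case: (rev a') => [//|_ s'] /= -[->].
  move=> aa' bb'; have [[e] _] := req_ends aa'; rewrite -{x'}e in aa' bb' *.
  rewrite -!cat_rcons -!rev_cons; apply: req_comp bb' aa' _.
  by rewrite revK.
Qed.

Lemma req_catr (r : seq P) s t : req s t -> is_ppath (s ++ r) -> req (s ++ r) (t ++ r).
Proof.
move=> st h; rewrite -[s ++ r]revK -[t ++ r]revK; apply: req_rev.
by rewrite !rev_cat; apply: req_catl; [exact: req_rev | rewrite -rev_cat is_ppath_rev].
Qed.

Lemma req_ctx (l r : seq P) s t :
  req s t -> is_ppath (l ++ s ++ r) -> req (l ++ s ++ r) (l ++ t ++ r).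
Proof.
move=> st h; apply: req_catl (h); apply: req_catr (st) _.
have [+ _] := req_ppath st; case: l h => [|x l] //=.
by case: s {st} => [//|y s]; rewrite cat_path /= => /and3P[_ _].
Qed.

Lemma req_cat s s' t t' :
  req s s' -> req t t' -> is_ppath (s ++ t) -> req (s ++ t) (s' ++ t').
Proof.
move=> ss' tt' h; have h1 := req_catr ss' h.
by apply: req_trans (h1) _; apply: req_catl tt' _; have [] := req_ppath h1.
Qed.

Lemma scanl_chain r x s : is_ppath (x :: s) -> r \T_x = r -> is_ppath (L r (x :: s)).
Proof.
move=> + h; rewrite /= h; elim: s x r h => //= y s IH x r h /andP[xy ys].
by rewrite (frel_below xy h) (IH y) // th_idem.
Qed.

Lemma foldl_below r x s : is_ppath (x :: s) -> E r (x :: s) \T_(last x s) = E r (x :: s).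
Proof. by rewrite lastI /E foldl_rcons th_idem. Qed.

Lemma ohead_rev_scanl r x s : ohead (rev (L r (x :: s))) = Some (E r (x :: s)).
Proof.
elim: s x r => [|y s IH] x r //.
have -> : L r [:: x, y & s] = r \T_x :: L (r \T_x) (y :: s) by [].
rewrite rev_cons; move: (IH y (r \T_x)).
by case: (rev _) => [|? ?] //= -[->].
Qed.

Lemma req_scanl r s t x : req s t -> ohead s = Some x -> r \T_x = r ->
  req (L r s) (L r t).
Proof.
case=> [a [b [<- <- ab]]]; elim: ab x r => {s t a b}
  [a b g|a|a b ab IH|b a c ab IH1 bc IH2|a a' b b' h h' aa' IHa bb' IHb] x r.
- case: g => [p|p q pq|p e f [hf he]] /= -[<-] h; rewrite /L /= h.
  + by rewrite h; apply: req_id.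
  + have -> : r \T_q \T_p = r by rewrite -[in LHS]h frel_thK.
    exact/req_inv/(frel_below pq).
  + have e1 : r \T_(e \T_p) = r \T_p by rewrite -th_conj -{1}h th_mul2 h.
    have e2 : r \T_(f \T_p) \T_f = r \T_p \T_f by rewrite -th_conj th_mul2.
    have K : r \T_p \T_f \T_p \T_r = r.
      by rewrite th_conj th_proj -(th_below _ h) -he th_proj h.
    rewrite e1 e2 -th_conj; apply: req_linked; split; last by rewrite K.
    by rewrite -[_ \T_(_ \T_f)]th_conj -th_conj K.
- by case: (pseq a) (ppathP a) => //= y s h [<-] h'; apply: req_refl; apply: scanl_chain.
- have [+ _] := pcong_ends ab; rewrite /pdom => <- e h; apply: req_sym; exact: IH e h.
- move=> e h; apply: req_trans (IH1 _ _ e h) _; apply: IH2 (h).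
  by have [+ _] := pcong_ends ab; rewrite /pdom => <-.
- have [eb _] := pcong_ends bb'; move: h eb IHa IHb; rewrite /pcod /pdom /=.
  case: (pseq a) (ppathP a) => [//|z s] hs; case: (pseq a') (ppathP a') => [//|z' s'] hs'.
  case: (pseq b) (ppathP b) => [//|y t] ht; case: (pseq b') (ppathP b') => [//|y' t'] ht' /=.
  move=> ez [<-] IHa IHb ex hr; have Ra := IHa _ _ ex hr.
  have hy : last z s = y.
    by move: ez; rewrite lastI rev_rcons => -[].
  have hr1 : E r (z :: s) \T_y = E r (z :: s) by rewrite -hy foldl_below.
  have er : E r (z' :: s') = E r (z :: s).
    by have [_] := req_ends Ra; rewrite !ohead_rev_scanl => -[].
  have Rb := IHb _ _ erefl hr1; rewrite hr1 in Rb.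
  change (req (L r ((z :: s) ++ t)) (L r ((z' :: s') ++ t'))).
  rewrite /L !scanl_cat -/L -[foldl _ r (z :: s)]/(E r (z :: s)).
  rewrite -[foldl _ r (z' :: s')]/(E r (z' :: s')) er.
  exact: req_comp Ra Rb (ohead_rev_scanl _ _ _).
Qed.

Lemma foldl_rev r x s : is_ppath (x :: s) -> r \T_x = r ->
  E (E r (x :: s)) (rev (x :: s)) = r.
Proof.
move=> + h; elim: s x r h => [|y s IH] x r h; first by rewrite /E /= !h.
move=> /= /andP[xy ys]; rewrite rev_cons /E foldl_rcons -/E h.
have := IH y (r \T_y) (th_idem _ _) ys; rewrite /= th_idem => ->.
by rewrite -{1}h frel_thK.
Qed.

Lemma scanl_rev r x s : is_ppath (x :: s) -> r \T_x = r ->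
  rev (L (E r (x :: s)) (rev (x :: s))) = L r (x :: s).
Proof.
move=> + h; elim: s x r h => [|y s IH] x r h; first by rewrite /L /E /= !h.
move=> xys; have /andP[xy ys] := xys; move: (foldl_rev xys h).
rewrite rev_cons /L scanl_rcons rev_rcons -/E => ->; rewrite -/L.
by have := IH y (r \T_y) (th_idem _ _) ys; rewrite /= th_idem h => ->.
Qed.

Lemma th_mono r q y : r \T_q = r -> r \T_y \T_(q \T_y) = r \T_y.
Proof. by move=> h; rewrite -th_conj th_idem -{1}h th_mul2 h. Qed.

Lemma th_mono1 r q y : r \T_q = r -> r \T_(q \T_y) = r \T_y.
Proof. by move=> h; rewrite -th_conj -{1}h th_mul2 h. Qed.

Lemma scanl_below r q x s : q \T_x = q -> r \T_q = r ->
  L r (L q (x :: s)) = L r (x :: s).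
Proof.
elim: s x r q => [|y s IH] x r q h1 h2.
  by rewrite /L /= h1 h2 -h2 th_belowr.
have h3 : r \T_x = r by rewrite -h2 th_belowr.
have := IH y (r \T_y) (q \T_y) (th_idem _ _) (th_mono _ h2).
by rewrite /= h1 h2 h3 !th_idem !(th_mono _ h2) !(th_mono1 _ h2) => -[->].
Qed.

Lemma foldl_below2 r q x s : q \T_x = q -> r \T_q = r ->
  E r (L q (x :: s)) = E r (x :: s).
Proof.
move=> h1 h2; have := congr1 (fun u => ohead (rev u)) (scanl_below s h1 h2).
by rewrite /= !ohead_rev_scanl => -[].
Qed.

Lemma th_transport x y e f : frel x y -> e \T_x = e -> f \T_x = f ->
  e \T_y \T_(f \T_y) = e \T_f \T_y.
Proof.
move=> xy he hf.
by rewrite -th_conj th_idem -(th_below _ hf) -{1}he (frel_thK _ xy) he (th_belowr _ hf).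
Qed.

Lemma foldl_mul e f x s : is_ppath (x :: s) -> e \T_x = e -> f \T_x = f ->
  E (e \T_f) (x :: s) = E e (x :: s) \T_(E f (x :: s)).
Proof.
elim: s x e f => [|y s IH] x e f xs he hf.
  by rewrite /E /= he hf th_belowr.
have /andP[xy ys] := xs; have ef := th_transport xy he hf.
transitivity (E (e \T_y \T_(f \T_y)) (y :: s)).
  by rewrite /E /= (th_belowr _ hf) ef th_idem.
by rewrite IH ?th_idem // /E /= he hf !th_idem.
Qed.

Lemma req_square a b y z : frel y z -> a \T_y = a -> b \T_y = b -> frel a b ->
  req [:: a; a \T_z; b \T_z] [:: a; b; b \T_z].
Proof.
move=> yz ha hb ab; have [h1 h2] := frelP _ _ ab.
have bzy : b \T_z \T_y = b by rewrite -[in LHS]hb frel_thK.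
have e1 : b \T_z \T_a = a by rewrite -(th_below _ ha) bzy h1.
have e2 : a \T_(b \T_z) = b \T_z.
  by rewrite -th_conj -(th_below _ hb) -{1}ha (frel_thK _ yz) ha h2 hb.
have l1 : linked z a (b \T_z).
  by split; rewrite ?th_idem // (th_transport yz) // h2.
have l2 : linked y a (b \T_z) by rewrite /linked ha bzy.
have aba : frel a (b \T_z) by apply/frelP; split.
have r1 : req [:: a; b \T_z; b \T_z] [:: a; b \T_z].
  by apply: (req_catl (l := [:: a]) (req_id _)) => /=; rewrite aba frel_refl.
have r2 : req [:: a; a; b \T_z] [:: a; b \T_z].
  by apply: (req_catr (r := [:: b \T_z]) (req_id a)) => /=; rewrite aba frel_refl.
have := req_linked l1; rewrite th_idem => r3; apply: req_trans r3 _.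
apply: req_trans r1 _; apply: req_sym.
by have := req_sym (req_linked l2); rewrite ha bzy => r4; apply: req_trans r4 _.
Qed.

Lemma frel_nat a b y t : is_ppath (y :: t) -> a \T_y = a -> b \T_y = b ->
  frel a b ->
  req (rcons (L a (y :: t)) (E b (y :: t))) (a :: L b (y :: t)).
Proof.
elim: t y a b => [|z t IH] y a b ht ha hb ab.
  by rewrite /L /E /= ha hb; apply: req_refl; rewrite /= ab.
have /andP[yz zt] := ht.
have abz : frel (a \T_z) (b \T_z).
  have [h1 h2] := frelP _ _ ab.
  by apply/frelP; rewrite !(th_transport yz) // h1 h2.
have R := IH z _ _ zt (th_idem _ _) (th_idem _ _) abz.
have sq := req_square yz ha hb ab.
have -> : rcons (L a [:: y, z & t]) (E b [:: y, z & t]) =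
    [:: a] ++ rcons (L (a \T_z) (z :: t)) (E (b \T_z) (z :: t)).
  by rewrite /L /E /= ha hb !th_idem.
have R1 : is_ppath (a :: rcons (L (a \T_z) (z :: t)) (E (b \T_z) (z :: t))).
  have [+ _] := req_ppath R; rewrite /= th_idem => ->; rewrite andbT.
  exact: frel_below yz ha.
have R2 := req_catl (l := [:: a]) R R1; apply: req_trans (R2) _.
have [_] := req_ppath R2.
have e : L (b \T_z) (z :: t) = b \T_z :: L (b \T_z) t by rewrite /L /= th_idem.
have -> : L b [:: y, z & t] = [:: b, b \T_z & L (b \T_z) t] by rewrite /L /= hb.
by rewrite e => R3; apply: (req_catr (r := L (b \T_z) t) sq) R3.
Qed.

Lemma req_corner x y y1 : y1 \T_y = y1 ->
  req [:: y1 \T_x; y1 \T_(x \T_y); x \T_y \T_y1] [:: y1 \T_x; x \T_y \T_y1].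
Proof.
move=> h; rewrite (th_belowl _ h) -th_conj h.
have l : linked y (y1 \T_x) (x \T_y1).
  split; first by rewrite -th_conj (th_belowl _ h) th_mul2 th_proj.
  by rewrite (th_belowr _ h) -th_conj !th_proj.
have := req_linked l; rewrite (th_belowr _ h) => r; apply: req_trans (r) _.
have [_ r1] := req_ppath r.
exact: (req_catl (l := [:: y1 \T_x]) (req_id _)) r1.
Qed.

Lemma bullet_seqE s x y t : bullet_seq (rcons s x) (y :: t) =
  rev (L (y \T_x) (rev (rcons s x))) ++ L (x \T_y) (y :: t).
Proof. by rewrite /bullet_seq rev_rcons. Qed.

Lemma bullet_rev s t : is_ppath s -> is_ppath t ->
  rev (bullet_seq s t) = bullet_seq (rev t) (rev s).
Proof.
case/lastP: s => // s x _; case: t => // y t _.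
by rewrite rev_cons rev_rcons !bullet_seqE rev_cat revK rev_rcons -rev_cons revK.
Qed.

Lemma bullet_ppath s t : is_ppath s -> is_ppath t -> is_ppath (bullet_seq s t).
Proof.
case/lastP: s => // s x; rewrite -is_ppath_rev => hs; case: t => // y t ht.
rewrite bullet_seqE; rewrite rev_rcons in hs *.
have h1 := scanl_chain hs (th_idem x y); have h2 := scanl_chain ht (th_idem y x).
rewrite -is_ppath_rev in h1; rewrite /L /= !th_idem -/L in h1 h2 *.
by rewrite rev_cons in h1 *; rewrite is_ppath_cat; apply/and3P; split=> //; exact: frel_th.
Qed.

Definition bullet (a b : ppath) : ppath := PPath (bullet_ppath (ppathP a) (ppathP b)).

Lemma bullet_req a a' b b' : pcong a a' -> pcong b b' ->
  pcong (bullet a b) (bullet a' b').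
Proof.
move=> aa' bb'; apply: reqP; move: (bullet_ppath (ppathP a) (ppathP b)) => /=.
have {aa'} : req a a' by exists a, a'.
have {bb'} : req b b' by exists b, b'.
case: (pseq b) (ppathP b) => [//|y t] ht; case: (pseq b') (ppathP b') => [//|y' t'] ht'.
case/lastP: (pseq a) (ppathP a) => [//|s x] hs.
case/lastP: (pseq a') (ppathP a') => [//|s' x'] hs' bb' aa'.
have [[ey] _] := req_ends bb'; have [_] := req_ends aa'; rewrite !rev_rcons => -[ex].
rewrite -{y'}ey -{x'}ex in hs' ht' aa' bb' *; rewrite !bullet_seqE; apply: req_cat.
  apply/req_rev/(req_scanl (x := x)); [exact: req_rev|by rewrite rev_rcons|exact: th_idem].
exact: (req_scanl (x := y)) bb' _ (th_idem _ _).
Qed.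

Lemma foldl_end r y t z t' : is_ppath (y :: t) -> rev (y :: t) = z :: t' ->
  E r (z :: t') \T_y = E r (z :: t').
Proof.
move=> ht rt; have ht' : is_ppath (z :: t') by rewrite -rt is_ppath_rev.
have <- : last z t' = y by move: rt; rewrite rev_cons lastI => /rcons_inj[].
exact: foldl_below.
Qed.

Lemma scanl_last r x s :
  L r (x :: s) = rcons (L r (belast x s)) (E r (x :: s)).
Proof. by rewrite {1}lastI /L scanl_rcons -lastI. Qed.

Lemma bullet_left s x y t z t' w u :
  is_ppath (x :: s) -> is_ppath (y :: t) -> rev (y :: t) = z :: t' ->
  let m := w \T_z in let y1 := E m (rev (y :: t)) in
  let t1 := E (x \T_y) (y :: t) in
  bullet_seq (bullet_seq (rev (x :: s)) (y :: t)) (w :: u) =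
  rev (L (y1 \T_x) (x :: s)) ++ L (y1 \T_(x \T_y)) (y :: t) ++
  L (t1 \T_w) (w :: u).
Proof.
move=> hs ht rt m y1 t1.
have ht' : is_ppath (z :: t') by rewrite -rt is_ppath_rev.
have lz : last y t = z by move: rt; rewrite lastI rev_rcons => -[].
have ht1 : t1 \T_z = t1 by rewrite -lz foldl_below.
have y1y : y1 \T_y = y1 by rewrite /y1 rt; exact: foldl_end rt.
have Ek : E (w \T_t1) (z :: t') = y1 \T_(x \T_y).
  rewrite -(th_belowl _ ht1) foldl_mul ?th_idem // -/m -rt -/y1.
  by rewrite foldl_rev // th_idem.
have revB : rev (L (x \T_y) (y :: t)) = L t1 (z :: t').
  by rewrite -(scanl_rev ht (th_idem _ _)) revK rt.
have hk : w \T_t1 \T_z = w \T_t1 by rewrite th_belowr.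
have Lk : rev (L (w \T_t1) (z :: t')) = L (y1 \T_(x \T_y)) (y :: t).
  by rewrite -(scanl_rev ht' hk) revK Ek -rt revK.
rewrite [rev (x :: s)]rev_cons bullet_seqE -rev_cons revK.
rewrite /bullet_seq rev_cat revK revB.
have -> : L t1 (z :: t') ++ L (y \T_x) (x :: s) =
    t1 :: (L t1 t' ++ L (y \T_x) (x :: s)) by rewrite /L /= ht1.
rewrite -[scanl _ (t1 \T_w) _]/(L (t1 \T_w) (w :: u)) catA; congr (_ ++ _).
have -> : t1 :: (L t1 t' ++ L (y \T_x) (x :: s)) =
    L t1 (z :: t') ++ L (y \T_x) (x :: s) by rewrite /L /= ht1.
rewrite scanl_cat -/L -/E scanl_below ?th_idem // foldl_below2 ?th_idem //.
rewrite rev_cat Lk Ek; congr (rev _ ++ _).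
have e : y1 \T_(x \T_y) \T_(y \T_x) = y1 \T_x by rewrite -!th_conj !th_mul2 y1y.
rewrite -(@scanl_below (y1 \T_x) (y \T_x)) ?th_idem //; last by rewrite -e th_idem.
by rewrite /L /= !th_idem e -[in RHS]e th_idem e.
Qed.

Lemma bullet_reqA s t u : is_ppath s -> is_ppath t -> is_ppath u ->
  req (bullet_seq (bullet_seq s t) u) (bullet_seq s (bullet_seq t u)).
Proof.
move=> hs ht hu.
have hl := bullet_ppath (bullet_ppath hs ht) hu.
have hr := bullet_ppath hs (bullet_ppath ht hu).
move: hs hl hr; rewrite -[s]revK is_ppath_rev.
case: (rev s) => [//|x {}s] hs; case: t ht => [//|y t] ht; case: u hu => [//|w u] hu.
case rt: (rev (y :: t)) (ht) => [|z t']; rewrite -is_ppath_rev rt // => ht'.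
have rt' : rev (z :: t') = y :: t by rewrite -rt revK.
rewrite (bullet_left _ _ hs ht rt).
move=> hl _; have hs' : is_ppath (rev (x :: s)) by rewrite is_ppath_rev.
have -> : bullet_seq (rev (x :: s)) (bullet_seq (y :: t) (w :: u)) =
    rev (bullet_seq (bullet_seq (rev (w :: u)) (rev (y :: t))) (x :: s)).
  by rewrite -[LHS]revK bullet_rev ?bullet_ppath // revK (bullet_rev ht hu).
rewrite rt (bullet_left _ _ hu ht' rt') !rev_cat revK -catA rt'.
move: hl; rewrite rt; set m := w \T_z; set y1 := E m _; set t1 := E _ (y :: t).
have y1y : y1 \T_y = y1 := foldl_end m ht rt.
have t1z : t1 \T_z = t1 := foldl_end (x \T_y) ht' rt'.
have Ey1 : E y1 (y :: t) = m by rewrite -rt' foldl_rev // th_idem.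
set a := y1 \T_(x \T_y); set b := x \T_y \T_y1.
have ay : a \T_y = a by rewrite /a th_belowr // th_idem.
have yb : b \T_y = b by rewrite /b th_belowr.
have Ea : E a (y :: t) = m \T_t1 by rewrite foldl_mul ?th_idem // Ey1.
have Eb : E b (y :: t) = t1 \T_m by rewrite foldl_mul ?th_idem // Ey1.
have -> : rev (L (t1 \T_m) (z :: t')) = L b (y :: t).
  by rewrite -(scanl_rev ht yb) Eb rt.
have -> : L (t1 \T_w) (w :: u) = t1 \T_w :: L (t1 \T_w) u.
  by rewrite /L /= th_idem.
have -> : rev (L (y1 \T_x) (x :: s)) = rcons (rev (L (y1 \T_x) s)) (y1 \T_x).
  by rewrite /L /= th_idem rev_cons.
set A := rev _; set C := L _ u.
have La := scanl_last a y t; have Lb : L b (y :: t) = b :: L b t by rewrite /L /= yb.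
rewrite Ea in La; set a1 := m \T_t1 in La; set b1 := t1 \T_m in Eb.
have c1 := req_corner x y1y; rewrite -/a -/b in c1.
have c2 := req_sym (req_rev (req_corner w t1z)); rewrite /rev /= -/m -/a1 -/b1 in c2.
have c3 := frel_nat ht ay yb (frel_th _ _); rewrite Eb Lb in c3.
move=> h1.
have R1 : req (rcons A (y1 \T_x) ++ L a (y :: t) ++ t1 \T_w :: C)
    (rcons A (y1 \T_x) ++ rcons (L a (y :: t)) b1 ++ t1 \T_w :: C).
  have := req_ctx (l := rcons A (y1 \T_x) ++ L a (belast y t)) (r := C) c2.
  by rewrite La -!catA !cat_rcons; apply; rewrite La !cat_rcons in h1.
apply: req_trans (R1) _; have [_ h2] := req_ppath R1.
have R2 := req_ctx c3 h2; apply: req_trans (R2) _; have [_ h3] := req_ppath R2.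
have := req_ctx (l := A) (r := L b t ++ t1 \T_w :: C) c1.
by rewrite Lb !cat_rcons; apply; rewrite !cat_rcons in h3.
Qed.

Definition PG := {eq_quot pcong_equiv}.

HB.instance Definition _ := Choice.on PG.
HB.instance Definition _ := EqQuotient.on PG.

Lemma PGP (a b : ppath) : \pi_PG a = \pi_PG b <-> pcong a b.
Proof. by split=> [/eqmodP/asboolP//|ab]; apply/eqmodP/asboolP. Qed.

Definition PG_mul : PG -> PG -> PG := lift_op2 PG bullet.

Fact pi_PG_mul : {morph \pi_PG : a b / bullet a b >-> PG_mul a b}.
Proof.
move=> a b; unlock PG_mul; apply/PGP.
by apply: bullet_req; apply/PGP; rewrite reprK.
Qed.

Fact PG_mulA : associative PG_mul.
Proof.
elim/quotW=> a; elim/quotW=> b; elim/quotW=> c.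
rewrite -!pi_PG_mul; apply/PGP/pcong_sym/reqP.
by apply: bullet_reqA; exact: ppathP.
Qed.

HB.instance Definition _ := isSemigroup.Build PG PG_mulA.

End Paths.

(** The relations [R_P], over an alphabet with letters [x_p = x p]. *)
Inductive pres_PG (P : projectionAlgebra) (X : Type) (x : P -> X) :
    word X -> word X -> Prop :=
| pres_PG_idem p :
    pres_PG x (letter (x p) * letter (x p))%g (letter (x p))
| pres_PG_mul2 p q :
    pres_PG x ((letter (x p) * letter (x q)) * (letter (x p) * letter (x q)))%g
      (letter (x p) * letter (x q))%g
| pres_PG_proj p q :
    pres_PG x (letter (x p) * letter (x q) * letter (x p))%g
      (letter (x (q \T_p))).

(* Main.v *)
Require Import Defs.
From HB Require Import structures.
From mathcomp Require Import all_boot.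

Set Implicit Arguments.
Unset Strict Implicit.
Unset Printing Implicit Defensive.

Local Open Scope group_scope.
Local Open Scope quotient_scope.

(** Both semigroups solve the same universal problem. Call a map [h] from [P]
    to a semigroup [T] a representation of [P] when its values satisfy the
    relations [R_P]. By construction the presented semigroup is the target of a
    universal representation; the theorem says that [PG P] is one as well, with
    [p] represented by the class [PG_proj p] of the one-point path [(p)].

    - The elements [PG_proj p] satisfy [R_P] ([PG_projection_rep]) and generate
      [PG P], because the class of [(p_1, ..., p_k)] is the product of the
      [PG_proj p_i] ([bullet_path_cons]). So at most one morphism extends a
      given representation ([PG_hom_eq]).
    - The morphism extending [h] has to send the class of [(p_1, ..., p_k)] to
      [h p_1 * ... * h p_k]. This product does not depend on the path chosen in
      the class ([pcong_prod]): for the pair given by linked projections, both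
      [h e * h (e \T_p) * h f] and [h e * h (f \T_p) * h f] reduce to
      [h e * h p * h f].
    - It is multiplicative because [R_P] implies [h r * h q = h r * h (r \T_q)]
      ([rep_restr]) and its mirror image. Applied along a path, this identity
      replaces the letters [p_i] by the successive restrictions
      [r theta_{p_1} ... theta_{p_i}], and such restrictions are the entries of
      the product of two paths ([prod_bullet]).

    The two universal morphisms are mutually inverse, since their composites fix
    the generators. *)

(** * Products in a semigroup with an identity adjoined *)

(** The monoid [T^1]: in it, products over possibly empty sequences exist, so
    that they can be cut at any place. *)
Definition adjoin1 (T : Type) : Type := option T.

Section Adjoin1.
Variable T : semigroupType.

HB.instance Definition _ := Choice.copy (adjoin1 T) (option T).

Definition adjoin1_mul (a b : adjoin1 T) : adjoin1 T :=
  match a, b with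
  | Some a', Some b' => Some (a' * b')
  | None, _ => b
  | _, None => a
  end.

Fact adjoin1_mulA : associative adjoin1_mul.
Proof. by move=> [a|] [b|] [c|] //=; rewrite mulgA. Qed.

HB.instance Definition _ := isSemigroup.Build (adjoin1 T) adjoin1_mulA.

Fact adjoin1_mul1 : left_id None adjoin1_mul.
Proof. by case. Qed.

Fact adjoin1_1mul : right_id None adjoin1_mul.
Proof. by case. Qed.

HB.instance Definition _ :=
  Semigroup_isMonoid.Build (adjoin1 T) adjoin1_mul1 adjoin1_1mul.

Definition emb1 (a : T) : adjoin1 T := Some a.

Lemma emb1M : {morph emb1 : a b / a * b}.
Proof. by []. Qed.

Lemma emb1_inj : injective emb1.
Proof. by move=> a b []. Qed.

End Adjoin1.

(** * Extending maps to words and to presented semigroups *)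

Section Eval.
Variables (X : Type) (T : semigroupType) (h : X -> T).

Definition eval1 (s : seq X) : adjoin1 T := \prod_(y <- s) emb1 (h y).

Lemma eval1_cons y s : eval1 (y :: s) = emb1 (h y) * eval1 s.
Proof. exact: big_cons. Qed.

Lemma eval1_cat s t : eval1 (s ++ t) = eval1 s * eval1 t.
Proof. exact: big_cat. Qed.

Lemma eval1_seq1 y : eval1 [:: y] = emb1 (h y).
Proof. exact: big_seq1. Qed.

Definition eval_seq (s : seq X) : 0 < size s -> T :=
  if s is y :: s' then fun=> foldl (fun a z => a * h z) (h y) s'
  else fun abs => False_rect T (notF abs).

Definition eval (u : word X) : T := eval_seq (wseqP u).

Lemma evalE u : emb1 (eval u) = eval1 u.
Proof.
case: u => -[//|y s] ys; rewrite /eval /= eval1_cons.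
elim: s (h y) {ys} => [|z s IH] a /=; first by rewrite /eval1 big_nil mulg1.
by rewrite IH eval1_cons mulgA emb1M.
Qed.

Lemma eval_mul : {morph eval : u v / u * v}.
Proof. by move=> u v; apply: emb1_inj; rewrite emb1M !evalE eval1_cat. Qed.

Lemma eval_letter y : eval (letter y) = h y.
Proof. by []. Qed.

End Eval.

Lemma word_ind (X : Type) (A : word X -> Prop) :
  (forall y, A (letter y)) -> (forall y u, A u -> A (letter y * u)) ->
  forall u, A u.
Proof.
move=> A1 AM [s]; case: s => // y s ys.
elim: s y ys => [|z s IH] y ys.
  by rewrite (_ : Word ys = letter y) //; apply: word_inj.
rewrite (_ : Word ys = letter y * Word (isT : 0 < size (z :: s))).
  exact/AM/IH.
exact: word_inj.
Qed.

Section PresentedLift.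
Variables (X : Type) (R : word X -> word X -> Prop) (T : semigroupType).

Lemma pi_presentedM : {morph \pi_(presented R) : u v / u * v}.
Proof. exact: pi_pres_mul. Qed.

Lemma presented_hom_eq (f g : presented R -> T) :
    {morph f : a b / a * b} -> {morph g : a b / a * b} ->
    (forall y, f (\pi_(presented R) (letter y)) = g (\pi_(presented R) (letter y))) ->
  f =1 g.
Proof.
move=> fM gM fg; elim/quotW=> u; elim/word_ind: u => [y|y u IH]; first exact: fg.
by rewrite pi_presentedM fM gM fg IH.
Qed.

Variable h : X -> T.
Hypothesis hR : forall u v, R u v -> eval h u = eval h v.

Lemma cong_eval u v : cong_gen R u v -> eval h u = eval h v.
Proof.
elim=> {u v} [u v /hR//|//|//|v u w _ -> _ -> //|u u' v v' _ eu _ ev].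
by rewrite !eval_mul eu ev.
Qed.

Definition presented_lift (a : presented R) : T := eval h (repr a).

Lemma presented_liftE u : presented_lift (\pi_(presented R) u) = eval h u.
Proof.
by apply: cong_eval; apply/presentedP; rewrite reprK.
Qed.

Lemma presented_lift_mul : {morph presented_lift : a b / a * b}.
Proof.
elim/quotW=> u; elim/quotW=> v.
by rewrite -pi_presentedM !presented_liftE eval_mul.
Qed.

End PresentedLift.

(** * The universal property of [PG P] *)

Section ProjectionRep.
Variable P : projectionAlgebra.

Lemma pi_PGM : {morph \pi_(PG P) : a b / bullet a b >-> a * b}.
Proof. exact: pi_PG_mul. Qed.

(** The relations [R_P], read as a condition on the images of the letters. *)
Record projection_rep (T : semigroupType) (h : P -> T) : Prop := {
  rep_idem : forall p, h p * h p = h p;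
  rep_mul2 : forall p q, (h p * h q) * (h p * h q) = h p * h q;
  rep_proj : forall p q, h p * h q * h p = h (q \T_p)
}.

Section Lift.
Variables (T : semigroupType) (h : P -> T).
Hypothesis hrep : projection_rep h.

Lemma rep_mul2A r q : h r * h q * h r * h q = h r * h q.
Proof. by rewrite -mulgA rep_mul2. Qed.

Lemma rep_restr r q : h r * h (r \T_q) = h r * h q.
Proof. by rewrite -(rep_proj hrep) !mulgA rep_mul2A. Qed.

Lemma rep_restl r q : h (r \T_q) * h r = h q * h r.
Proof. by rewrite -(rep_proj hrep) rep_mul2A. Qed.

Local Notation W := (eval1 h).
Local Notation restrict := (scanl (fun r p => r \T_p)).

(** The letters of [s] are exchanged one after the other by [rep_restr]: the new
    letter obtained at each step is the left neighbour that restricts the next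
    one. *)
Lemma prod_restr r s : emb1 (h r) * W s = emb1 (h r) * W (restrict r s).
Proof.
elim: s r => //= q s IH r; rewrite !eval1_cons -IH !mulgA -!emb1M.
by rewrite rep_restr.
Qed.

Lemma prod_restl r s :
  W (rev s) * emb1 (h r) = W (rev (restrict r s)) * emb1 (h r).
Proof.
elim: s r => //= q s IH r; rewrite !rev_cons -!cats1 !eval1_cat !eval1_seq1.
by rewrite -!mulgA -!emb1M -rep_restl emb1M !mulgA IH.
Qed.

Lemma prod_rcons_idem s p : W (rcons s p) * emb1 (h p) = W (rcons s p).
Proof. by rewrite -cats1 eval1_cat eval1_seq1 -mulgA -emb1M rep_idem. Qed.

(** Let [s] end in [p] and [t] start in [q]. As [h p] is idempotent, a second [p]
    can be inserted between [s] and [t], and it restricts [t] to [p]. The result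
    starts with [p \T_q], whose image absorbs [h q] on the left; the [q] thereby
    inserted restricts [s] to [q]. *)
Lemma prod_bullet s t :
  is_ppath s -> is_ppath t -> W (bullet_seq s t) = W s * W t.
Proof.
case/lastP: s => // s p _; case: t => // q t _.
rewrite bullet_seqE.
have -> : restrict (q \T_p) (rev (rcons s p)) = restrict q (rev (rcons s p)).
  by rewrite rev_rcons /= th_idem.
have -> : restrict (p \T_q) (q :: t) = restrict p (q :: t) by rewrite /= th_idem.
have qW : emb1 (h q) * W (restrict p (q :: t)) = W (restrict p (q :: t)).
  by rewrite /= eval1_cons mulgA -emb1M -(rep_proj hrep) !mulgA rep_idem.
rewrite eval1_cat -[in RHS]prod_rcons_idem -mulgA prod_restr mulgA.
by rewrite prod_rcons_idem -qW !mulgA -prod_restl revK.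
Qed.

(** The junction point of two composable paths occurs once in the composite and
    twice in the product; idempotence of its image makes up for this. *)
Lemma prod_pcomp (a b : ppath P) (ab : pcod a = pdom b) :
  W (Defs.pcomp ab) = W a * W b.
Proof.
case: a b ab => [s +] [[|q t] //] ht; case/lastP: s => // s p hs.
rewrite /pcod /pdom /= rev_rcons /= => -[<-].
by rewrite eval1_cat eval1_cons mulgA prod_rcons_idem.
Qed.

Lemma pcong_prod (a b : ppath P) : pcong a b -> W a = W b.
Proof.
elim=> {a b} [a b g||a b _ -> //|b a c _ -> _ -> //|a a' b b' ab ab' _ ea _ eb] //.
  case: g => [p|p q /frelP[e _]|p e f _]; rewrite !eval1_cons ?(mulgA (emb1 _)) -!emb1M.
  - by rewrite rep_idem.
  - by rewrite rep_proj // e.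
  (* Both sides become [h e * h p * h f]: the left one by the idempotence of
     [h e * h p], the right one by that of [h p * h f]. *)
  - rewrite -!(rep_proj hrep) !mulgA rep_mul2A.
    by rewrite -!(mulgA (h e)) rep_mul2A.
by rewrite !prod_pcomp ea eb.
Qed.

Fact ppath_size (a : ppath P) : (0 < size a)%N.
Proof. by case: a => -[]. Qed.

Definition path_word (a : ppath P) : word P := Word (ppath_size a).

Definition PG_lift (a : PG P) : T := eval h (path_word (repr a)).

Lemma PG_liftE a : emb1 (PG_lift (\pi_(PG P) a)) = W a.
Proof. by rewrite evalE; apply: pcong_prod; apply/PGP; rewrite reprK. Qed.

Lemma PG_lift_mul : {morph PG_lift : a b / a * b}.
Proof.
elim/quotW=> a; elim/quotW=> b; apply: emb1_inj.
by rewrite -pi_PGM emb1M !PG_liftE prod_bullet ?ppathP.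
Qed.

End Lift.

Definition ppath1 (p : P) : ppath P := @PPath P [:: p] isT.

Definition PG_proj (p : P) : PG P := \pi_(PG P) (ppath1 p).

Lemma PG_lift_proj (T : semigroupType) (h : P -> T) p :
  projection_rep h -> PG_lift h (PG_proj p) = h p.
Proof. by move=> hrep; apply: emb1_inj; rewrite PG_liftE // eval1_seq1. Qed.

Lemma restrict_path (r p : P) s : is_ppath (p :: s) -> r \T_p = p ->
  scanl (fun x q => x \T_q) r (p :: s) = p :: s.
Proof.
move=> + rp; rewrite /= rp; elim: s p {r rp} => //= q s IH p /andP[/frelP[_ pq] qs].
by rewrite pq; have [->] := IH _ qs.
Qed.

(** Consecutive projections [p], [q] of a path are [F]-related, so that
    [q \T_p = p] and [p \T_q = q]: the product path has the same entries. It follows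
    by induction that the class of a path is the product of the classes of its
    points. *)
Lemma bullet_path_cons (p q : P) s : is_ppath [:: p, q & s] ->
  bullet_seq [:: p] (q :: s) = [:: p, q & s].
Proof.
move=> /= /andP[/frelP[qp pq] qs].
by rewrite (bullet_seqE [::]) qp pq restrict_path ?th_id // /rev /= th_id.
Qed.

Lemma PG_hom_eq (T : semigroupType) (f g : PG P -> T) :
    {morph f : a b / a * b} -> {morph g : a b / a * b} ->
    (forall p, f (PG_proj p) = g (PG_proj p)) ->
  f =1 g.
Proof.
move=> fM gM fg; elim/quotW=> -[s]; case: s => // p s.
elim: s p => [|q s IH] p ps.
  by rewrite (_ : PPath ps = ppath1 p) ?fg //; apply: ppath_inj.
have qs : is_ppath (q :: s) by case/andP: (ps).
rewrite (_ : PPath ps = bullet (ppath1 p) (PPath qs)).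
  by rewrite pi_PGM fM gM fg IH.
by apply: ppath_inj; rewrite /= bullet_path_cons.
Qed.

(** The relation for [p * q * p] needs a cancellation [(p', q', p') = (p')] in
    the path category. It turns [(p * q) * (p * q)] into the product of
    [q \T_p] and [q], whose underlying path is already that of [p * q]. *)
Lemma PG_projection_rep : projection_rep PG_proj.
Proof.
have proj p q : PG_proj p * PG_proj q * PG_proj p = PG_proj (q \T_p).
  rewrite -!pi_PGM; apply/PGP/reqP; rewrite /= /bullet_seq /= !th_idem.
  (* The left-hand path comes down to [(q theta_p, p theta_q, q theta_p)]. *)
  rewrite /rev /= -!th_conj !th_proj.
  exact/req_inv/frel_th.
split=> // [p|p q].
  rewrite -pi_PGM; apply/PGP/reqP; rewrite /= /bullet_seq /= !th_id.
  exact: req_id.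
rewrite mulgA proj -!pi_PGM; congr (\pi_(PG P) _); apply: ppath_inj.
by rewrite /= /bullet_seq /= !th_idem -th_conj !th_proj.
Qed.

End ProjectionRep.

(** * The isomorphism *)

Lemma presented_projection_rep (P : projectionAlgebra) (X : Type) (x : P -> X) :
  projection_rep (fun p => \pi_(presented (pres_PG x)) (letter (x p))).
Proof.
by split=> *; rewrite -!pi_presentedM; apply/presentedP/cong_base; constructor.
Qed.

Theorem theorem7p2 (P : projectionAlgebra) (X : Type) (x : P -> X) :
  bijective x ->
  exists f : {multiplicative PG P -> presented (pres_PG x)}, bijective f.
Proof.
case=> y xK yK.
have xrep := presented_projection_rep x; have rep := PG_projection_rep P.
pose f := PG_lift (fun p => \pi_(presented (pres_PG x)) (letter (x p))).
pose g := @presented_lift _ (pres_PG x) _ (fun z => PG_proj (y z)).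
have fM : {morph f : a b / a * b} by exact: PG_lift_mul.
have gR u v : pres_PG x u v ->
    eval (fun z => PG_proj (y z)) u = eval (fun z => PG_proj (y z)) v.
  by case=> [p|p q|p q]; rewrite !eval_mul !eval_letter !xK; case: rep.
have gM : {morph g : a b / a * b} by exact: presented_lift_mul.
exists (HB.pack_for {multiplicative PG P -> presented (pres_PG x)} f
  (isMultiplicative.Build _ _ f fM)).
exists g => a /=.
  apply: (PG_hom_eq (f := g \o f) (g := id)) => [b c|//|p] /=.
    by rewrite fM gM.
  by rewrite /f PG_lift_proj // /g presented_liftE // eval_letter xK.
apply: (presented_hom_eq (f := f \o g) (g := id)) => [b c|//|z] /=.
  by rewrite gM fM.
by rewrite /g presented_liftE // eval_letter /f PG_lift_proj // yK.
Qed.
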